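(* Let $f\colon\mathbb{Z}\times\mathbb{R}^n\to\mathbb{R}^n$ be continuous and continuously differentiable in $x\in\mathbb{R}^n$, and consider the system $x(k+1)=f(k,x(k))$, $k\in\mathbb{Z}$. Suppose there exist a positive definite matrix $P\in\mathbb{R}^{n\times n}$ and some $\rho\in(0,1)$ such that the matrix $$J(k,x):=\frac{\partial f}{\partial x}(k,x)^TP\,\frac{\partial f}{\partial x}(k,x)-\rho P$$ is negative semidefinite for all $(k,x)\in\mathbb{Z}\times\mathbb{R}^n$ (with $P$ and $\rho$ independent of $(k,x)$). Then the system is uniformly globally exponentially incrementally stable and (uniformly) globally contracting. Furthermore, if there exists $c\geq0$ such that $$\sup_{k\in\mathbb{Z}}|f(k,0)|=c<\infty,$$ then the system is uniformly globally exponentially convergent.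
   Context: $|\cdot|$ is the Euclidean norm; positive definite matrices are symmetric. For symmetric $A,B\in\mathbb{R}^{n\times n}$, $A\preceq B$ means $x^TAx\leq x^TBx$ for all $x\in\mathbb{R}^n$. For $k_0\in\mathbb{Z}$ and $\xi\in\mathbb{R}^n$, $\phi(\cdot;k_0,\xi)\colon\mathbb{Z}_{\geq k_0}\to\mathbb{R}^n$ denotes the solution: $\phi(k_0;k_0,\xi)=\xi$ and $\phi(k+1;k_0,\xi)=f(k,\phi(k;k_0,\xi))$ for all $k\geq k_0$. The system is uniformly globally exponentially incrementally stable if there exist $\kappa\geq1$ and $\lambda>1$ such that $|\phi(k;k_0,\xi_1)-\phi(k;k_0,\xi_2)|\leq\kappa|\xi_1-\xi_2|\lambda^{-(k-k_0)}$ for all $\xi_1,\xi_2\in\mathbb{R}^n$ and $k,k_0\in\mathbb{Z}$ with $k\geq k_0$. The system is uniformly globally contracting if there exist a function $\Theta\colon\mathbb{Z}\times\mathbb{R}^n\to\mathbb{R}^{n\times n}$ with nonsingular matrix values and constants $\mu,\eta,\rho'>0$ such that, for all $x\in\mathbb{R}^n$ and $k\in\mathbb{Z}$, $$\eta I\preceq\Theta(k,x)^T\Theta(k,x)\preceq\rho' I,\qquad F(k,x)^TF(k,x)-I\preceq-\mu I,$$ where $F(k,x)=\Theta\big(k+1,f(k,x)\big)\frac{\partial f}{\partial x}(k,x)\Theta(k,x)^{-1}$. The system is uniformly globally exponentially convergent if (a) there exists a unique bounded solution $\bar x(k)$ defined for all $k\in\mathbb{Z}$ (i.e. $\bar x\colon\mathbb{Z}\to\mathbb{R}^n$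 bounded with $\bar x(k+1)=f(k,\bar x(k))$ for all $k\in\mathbb{Z}$), and (b) there exist $\kappa\geq1$ and $\lambda>1$ such that $|\phi(k;k_0,\xi)-\bar x(k)|\leq\kappa|\xi-\bar x(k_0)|\lambda^{-(k-k_0)}$ for all $\xi\in\mathbb{R}^n$ and $k,k_0\in\mathbb{Z}$ with $k\geq k_0$. *)

(* Defs.v *)
From mathcomp Require Import all_boot all_order all_algebra.
From mathcomp Require Import all_classical all_reals all_analysis.

Set Implicit Arguments.
Unset Strict Implicit.
Unset Printing Implicit Defensive.

Import Order.TTheory GRing.Theory Num.Theory.
Import numFieldNormedType.Exports.

Local Open Scope classical_set_scope.
Local Open Scope ring_scope.

(* The library norm `|x| on matrices is the sup norm. *)
Definition enorm (R : realType) (n : nat) (x : 'cV[R]_n) : R :=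
  Num.sqrt (\sum_(i < n) x i ord0 ^+ 2).

Definition qform (R : realType) (n : nat) (A : 'M[R]_n) (x : 'cV[R]_n) : R :=
  (x^T *m A *m x) ord0 ord0.

Definition loewner_le (R : realType) (n : nat) (A B : 'M[R]_n) : Prop :=
  forall x : 'cV[R]_n, qform A x <= qform B x.

Definition posdefmx (R : realType) (n : nat) (A : 'M[R]_n) : Prop :=
  A^T = A /\ forall x : 'cV[R]_n, x != 0 -> 0 < qform A x.

Definition negsemidefmx (R : realType) (n : nat) (A : 'M[R]_n) : Prop :=
  forall x : 'cV[R]_n, qform A x <= 0.

(* The library's jacobian is for maps on row vectors acting on the right;
   this is the usual matrix of partial derivatives (D_j g_i)(x). *)
Definition Jmx (R : realType) (n : nat) (g : 'cV[R]_n -> 'cV[R]_n)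
    (x : 'cV[R]_n) : 'M[R]_n :=
  \matrix_(i, j) 'D_(delta_mx j ord0) (fun y => g y i ord0) x.

Lemma diff_Jmx (R : realType) (n : nat) (g : 'cV[R]_n -> 'cV[R]_n)
    (x v : 'cV[R]_n) :
  differentiable g x -> 'd g x v = Jmx g x *m v.
Proof.
move=> dg; apply/colP => i; rewrite mxE.
have coordE w : 'D_w (fun y => g y i ord0) x = ('d g x w) i ord0.
  apply: cvg_lim => //.
  have /cvg_ex[l lP] := diff_derivable dg (v := w).
  have <- : l = 'd g x w by rewrite -deriveE//; apply/esym/cvg_lim.
  apply: (@cvg_trans _ ((fun M : 'cV[R]_n => M i ord0) @
     ((fun h => h^-1 *: (g (h *: w + x) - g x)) @ 0^'))).
    apply: near_eq_cvg; near=> h; by rewrite /= !mxE.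
  exact: (cvg_comp _ _ lP (@coord_continuous _ _ _ i ord0 l)).
under eq_bigr do rewrite mxE coordE.
rewrite {1}(_ : v = \sum_j v j ord0 *: delta_mx j ord0); last first.
  by rewrite {1}[v]matrix_sum_delta; apply: eq_bigr => j _; rewrite big_ord1.
rewrite linear_sum summxE; apply: eq_bigr => j _.
by rewrite linearZ mxE mulrC.
Unshelve. all: by end_near. Qed.

(* phi k k0 xi for k0 <= k; meaningless when k < k0. *)
Definition phi (R : realType) (n : nat) (f : int -> 'cV[R]_n -> 'cV[R]_n)
    (k k0 : int) (xi : 'cV[R]_n) : 'cV[R]_n :=
  iteri `|k - k0|%N (fun m x => f (k0 + m%:Z) x) xi.

Lemma phi_init (R : realType) (n : nat) (f : int -> 'cV[R]_n -> 'cV[R]_n)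
    (k0 : int) (xi : 'cV[R]_n) : phi f k0 k0 xi = xi.
Proof. by rewrite /phi subrr. Qed.

Lemma phi_step (R : realType) (n : nat) (f : int -> 'cV[R]_n -> 'cV[R]_n)
    (k k0 : int) (xi : 'cV[R]_n) :
  k0 <= k -> phi f (k + 1) k0 xi = f k (phi f k k0 xi).
Proof.
rewrite -subr_ge0 => k0k; rewrite /phi addrAC.
case: (k - k0) k0k (subrK k0 k) => // m _ <-.
by rewrite -[Posz m + 1]/(Posz (m + 1)) addn1 /= addrC.
Qed.

Definition inc_exp_stable (R : realType) (n : nat)
    (f : int -> 'cV[R]_n -> 'cV[R]_n) : Prop :=
  exists kappa lambda : R, [/\ 1 <= kappa, 1 < lambda &
    forall (xi1 xi2 : 'cV[R]_n) (k k0 : int), k0 <= k ->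
      enorm (phi f k k0 xi1 - phi f k k0 xi2)
        <= kappa * enorm (xi1 - xi2) * lambda ^ (- (k - k0))].

Definition contracting (R : realType) (n : nat)
    (f : int -> 'cV[R]_n -> 'cV[R]_n) : Prop :=
  exists (Theta : int -> 'cV[R]_n -> 'M[R]_n) (mu eta rho' : R),
    [/\ forall k x, Theta k x \in unitmx, 0 < mu, 0 < eta, 0 < rho' &
      forall (x : 'cV[R]_n) (k : int),
        let F := Theta (k + 1) (f k x) *m Jmx (f k) x *m invmx (Theta k x) in
        [/\ loewner_le eta%:M ((Theta k x)^T *m Theta k x),
            loewner_le ((Theta k x)^T *m Theta k x) rho'%:M &
            loewner_le (F^T *m F - 1%:M) (- mu%:M)]].

Definition bounded_solution (R : realType) (n : nat)
    (f : int -> 'cV[R]_n -> 'cV[R]_n) (xbar : int -> 'cV[R]_n) : Prop :=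
  (exists M : R, forall k, enorm (xbar k) <= M) /\
  (forall k, xbar (k + 1) = f k (xbar k)).

Definition exp_convergent (R : realType) (n : nat)
    (f : int -> 'cV[R]_n -> 'cV[R]_n) : Prop :=
  exists xbar : int -> 'cV[R]_n,
    unique (bounded_solution f) xbar /\
    exists kappa lambda : R, [/\ 1 <= kappa, 1 < lambda &
      forall (xi : 'cV[R]_n) (k k0 : int), k0 <= k ->
        enorm (phi f k k0 xi - xbar k)
          <= kappa * enorm (xi - xbar k0) * lambda ^ (- (k - k0))].

(* Main.v *)
(** Factor P = S^T S with S invertible (Cholesky). The hypothesis on J says that
    the Jacobian is sqrt(rho)-Lipschitz for the norm |S x|; by the mean value
    theorem applied to <w, S f(k, .)> with w = S (f(k, x) - f(k, y)), so is
    f(k, .). Since |S x| is equivalent to |x|, incremental stability follows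
    by iteration, and Theta = S is a contraction metric. When f(., 0) is
    bounded, the map u |-> (k |-> f(k - 1, u(k - 1))) on bounded sequences is a
    contraction for the sup of |S u(k)|, and its fixed point is the bounded
    solution. *)
Require Import Defs.
From mathcomp Require Import all_boot all_order all_algebra.
From mathcomp Require Import all_classical all_reals all_analysis.
From mathcomp Require Import ring lra.

Import Order.TTheory GRing.Theory Num.Theory.
Import numFieldNormedType.Exports.

Local Open Scope classical_set_scope.
Local Open Scope ring_scope.

(** * Euclidean inner product, norm and quadratic forms *)

Definition dot {R : realType} {n : nat} (x y : 'cV[R]_n) : R :=
  \sum_(i < n) x i ord0 * y i ord0.

Section Euclidean.
Context {R : realType} {n : nat}.
Implicit Types x y z : 'cV[R]_n.

Lemma dotE x y : dot x y = (x^T *m y) ord0 ord0.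
Proof. by rewrite mxE; apply: eq_bigr => i _; rewrite mxE. Qed.

Lemma dotC x y : dot x y = dot y x.
Proof. by apply: eq_bigr => i _; rewrite mulrC. Qed.

Lemma dotDr x y z : dot x (y + z) = dot x y + dot x z.
Proof. by rewrite !dotE mulmxDr mxE. Qed.

Lemma dotZr a x y : dot x (a *: y) = a * dot x y.
Proof. by rewrite !dotE -scalemxAr mxE. Qed.

Lemma dotBr x y z : dot x (y - z) = dot x y - dot x z.
Proof. by rewrite -scaleN1r dotDr dotZr mulN1r. Qed.

Lemma dot_ge0 x : 0 <= dot x x.
Proof. by apply: sumr_ge0 => i _; rewrite -expr2 sqr_ge0. Qed.

Lemma sqr_enorm x : enorm x ^+ 2 = dot x x.
Proof.
rewrite sqr_sqrtr; first by apply: eq_bigr => i _; rewrite expr2.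
by apply: sumr_ge0 => i _; rewrite sqr_ge0.
Qed.

Lemma enorm_ge0 x : 0 <= enorm x.
Proof. exact: sqrtr_ge0. Qed.

Lemma ler_enorm x b : 0 <= b -> dot x x <= b ^+ 2 -> enorm x <= b.
Proof. by move=> b0; rewrite -sqr_enorm ler_pXn2r// nnegrE// enorm_ge0. Qed.

Lemma enormN x : enorm (- x) = enorm x.
Proof. by congr Num.sqrt; apply: eq_bigr => i _; rewrite mxE sqrrN. Qed.

Lemma enormB x y : enorm (x - y) = enorm (y - x).
Proof. by rewrite -opprB enormN. Qed.

Lemma enormZ a x : enorm (a *: x) = `|a| * enorm x.
Proof.
rewrite /enorm -sqrtr_sqr -sqrtrM ?sqr_ge0// mulr_sumr.
by congr Num.sqrt; apply: eq_bigr => i _; rewrite mxE exprMn.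
Qed.

Lemma enorm0 : enorm (0 : 'cV[R]_n) = 0.
Proof. by rewrite -(scale0r (0 : 'cV[R]_n)) enormZ normr0 mul0r. Qed.

Lemma coord_le_enorm x i : `|x i ord0| <= enorm x.
Proof.
rewrite -sqrtr_sqr ler_sqrt; last by apply: sumr_ge0 => j _; rewrite sqr_ge0.
by rewrite (bigD1 i)//= lerDl sumr_ge0// => j _; rewrite sqr_ge0.
Qed.

Lemma enorm_eq0 x : enorm x = 0 -> x = 0.
Proof.
move=> x0; apply/colP => i; rewrite mxE; apply/normr0_eq0/le_anti.
by rewrite normr_ge0 -x0 coord_le_enorm.
Qed.

Lemma dot_le_enorm x y : dot x y <= enorm x * enorm y.
Proof.
have [/enorm_eq0 ->|y0] := eqVneq (enorm y) 0.
  by rewrite enorm0 mulr0 /dot big1// => i _; rewrite mxE mulr0.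
have {}y0 : 0 < enorm y by rewrite lt_neqAle eq_sym y0 enorm_ge0.
(* This square expands to [2 |x| |y| (|x| |y| - dot x y)]; with both norms positive the factor in
   front can be cancelled. *)
have := dot_ge0 (enorm y *: x - enorm x *: y).
rewrite dotBr !dotZr ![dot (_ - _) _]dotC !dotBr !dotZr (dotC y x).
rewrite -!sqr_enorm => H.
have [/enorm_eq0 ->|x0] := eqVneq (enorm x) 0.
  by rewrite enorm0 mul0r /dot big1// => i _; rewrite mxE mul0r.
have {}x0 : 0 < enorm x by rewrite lt_neqAle eq_sym x0 enorm_ge0.
have : 0 <= (2 * (enorm x * enorm y)) * (enorm x * enorm y - dot x y).
  by move: H; congr (0 <= _); ring.
by rewrite pmulr_rge0 ?mulr_gt0// subr_ge0.
Qed.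

Lemma enormD x y : enorm (x + y) <= enorm x + enorm y.
Proof.
apply: ler_enorm; first by rewrite addr_ge0 ?enorm_ge0.
rewrite dotDr ![dot (_ + _) _]dotC !dotDr (dotC y x) -!sqr_enorm.
by have := dot_le_enorm x y; lra.
Qed.

(** Under the hypothesis, [|x - y|^2] equals [|y|^2 - |x|^2]. This bounds [|x|] without dividing by
    it, so [x = 0] is no special case. *)
Lemma enorm_le_of_dot x y : dot x x = dot x y -> enorm x <= enorm y.
Proof.
move=> xy; apply: ler_enorm; first exact: enorm_ge0.
have := dot_ge0 (x - y).
rewrite dotBr ![dot (_ - _) _]dotC !dotBr (dotC y x) -xy sqr_enorm; lra.
Qed.

Lemma enorm_le_sum x : enorm x <= \sum_i `|x i ord0|.
Proof.
apply: ler_enorm; first by apply: sumr_ge0.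
rewrite expr2 mulr_suml ler_sum// => i _.
rewrite -expr2 -real_normK ?num_real// expr2 ler_wpM2l//.
by rewrite (bigD1 i)//= lerDl sumr_ge0.
Qed.

Lemma enorm_sum (I : Type) (r : seq I) (u : I -> 'cV[R]_n) :
  enorm (\sum_(i <- r) u i) <= \sum_(i <- r) enorm (u i).
Proof.
elim: r => [|i r IH]; first by rewrite !big_nil enorm0.
by rewrite !big_cons (le_trans (enormD _ _))// lerD2l.
Qed.

Lemma enorm_mulmx (A : 'M[R]_n) :
  exists2 C : R, 1 <= C & forall x, enorm (A *m x) <= C * enorm x.
Proof.
have C0 : 0 <= \sum_j enorm (col j A).
  by apply: sumr_ge0 => j _; rewrite enorm_ge0.
(* The column norms alone bound [A]; the added 1 makes the constant at least 1, as needed later for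
   [kappa] and for inverting constants. *)
exists (1 + \sum_j enorm (col j A)) => [|x]; first by rewrite lerDl.
have -> : A *m x = \sum_j x j ord0 *: col j A.
  apply/colP => i; rewrite mxE summxE.
  by apply: eq_bigr => j _; rewrite !mxE mulrC.
apply: (@le_trans _ _ (\sum_j enorm (x j ord0 *: col j A))).
  exact: enorm_sum.
rewrite mulrDl mul1r.
apply: (@le_trans _ _ ((\sum_j enorm (col j A)) * enorm x)); last first.
  by rewrite lerDr enorm_ge0.
rewrite mulr_suml ler_sum// => j _; rewrite enormZ mulrC.
by rewrite ler_wpM2l ?enorm_ge0// coord_le_enorm.
Qed.

Lemma qform_gram (A : 'M[R]_n) x : qform (A^T *m A) x = enorm (A *m x) ^+ 2.
Proof. by rewrite sqr_enorm dotE /qform trmx_mul !mulmxA. Qed.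

Lemma qformB (A B : 'M[R]_n) x : qform (A - B) x = qform A x - qform B x.
Proof. by rewrite /qform mulmxBr mulmxBl !mxE. Qed.

Lemma qformN (A : 'M[R]_n) x : qform (- A) x = - qform A x.
Proof. by rewrite /qform mulmxN mulNmx mxE. Qed.

Lemma qformZ a (A : 'M[R]_n) x : qform (a *: A) x = a * qform A x.
Proof. by rewrite /qform -scalemxAr -scalemxAl mxE. Qed.

Lemma qform_scalar a x : qform a%:M x = a * enorm x ^+ 2.
Proof. by rewrite -scalemx1 qformZ /qform mulmx1 sqr_enorm dotE. Qed.

Lemma qform_congr (A B : 'M[R]_n) x :
  qform (B^T *m A *m B) x = qform A (B *m x).
Proof. by rewrite /qform trmx_mul !mulmxA. Qed.

End Euclidean.

(** * Cholesky factorization *)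

(** Induction on the size: split off the first row and column, factor the Schur complement
    [D - a^-1 b^T b] as [S'^T S'], and border [S'] with the row [(sqrt a, b / sqrt a)]. *)
Lemma posdefmx_cholesky {R : realType} {n : nat} {P : 'M[R]_n} :
  posdefmx P -> exists2 S : 'M[R]_n, S \in unitmx & S^T *m S = P.
Proof.
elim: n P => [P _|n IH].
  by exists 1%:M; [exact: unitmx1|apply/matrixP => -[]].
rewrite -[n.+1]/(1 + n)%N => P [PT Ppos].
rewrite -(@submxK _ 1 n 1 n P) in PT Ppos *.
set a := ulsubmx _ in PT Ppos *; set b := ursubmx _ in PT Ppos *.
set c := dlsubmx _ in PT Ppos *; set D := drsubmx _ in PT Ppos *.
move: PT; rewrite tr_block_mx => /(@eq_block_mx R 1 n 1 n)[_ _ cE DT].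
rewrite -{}cE in Ppos *; clear c.
pose a0 := a ord0 ord0; have aE : a = a0%:M by exact: mx11_scalar.
have a0_gt0 : 0 < a0.
  have e0 : col_mx (1%:M : 'M[R]_1) (0 : 'cV[R]_n) != 0.
    apply/eqP => /(congr1 usubmx); rewrite col_mxKu linear0 => /matrixP.
    by move=> /(_ ord0 ord0)/eqP; rewrite !mxE/= oner_eq0.
  have := Ppos _ e0; rewrite /qform tr_col_mx -mulmxA mul_block_col mul_row_col.
  by rewrite !mulmx0 trmx0 mul0mx !addr0 trmx1 mul1mx mulmx1.
have a0_neq0 : a0 != 0 by rewrite gt_eqF.
have [|S' S'u S'E] := IH (D - a0^-1 *: (b^T *m b)).
  split; first by rewrite linearB linearZ /= trmx_mul trmxK DT.
  move=> y y0.
  (* The first coordinate is the one minimizing the form of [P] for fixed [y]; the minimum is the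
     form of the Schur complement at [y]. *)
  have e0 : col_mx (- a0^-1 *: (b *m y)) y != 0.
    apply: contraNneq y0 => /(congr1 dsubmx); rewrite col_mxKd => ->.
    by rewrite linear0.
  have := Ppos _ e0; congr (0 < _).
  rewrite /qform tr_col_mx -mulmxA mul_block_col mul_row_col aE.
  rewrite mul_scalar_mx scalerA mulrN divff// scaleN1r addNr mulmx0 add0r.
  rewrite -scalemxAr -mulmxA; congr ((_ *m _) _ _).
  by rewrite mulmxBl scaleNr -scalemxAl mulmxA addrC.
pose s := Num.sqrt a0.
have s2 : s * s = a0 by rewrite -expr2 sqr_sqrtr// ltW.
have s_neq0 : s != 0 by rewrite gt_eqF// sqrtr_gt0.
exists (block_mx s%:M (s^-1 *: b) 0 S').
  rewrite unitmxE det_ublock unitrM det_scalar expr1 -unitmxE S'u andbT.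
  by rewrite unitfE.
rewrite tr_block_mx mulmx_block tr_scalar_mx !trmx0 !mul0mx !mulmx0 !addr0.
rewrite -scalar_mxM s2 -aE mul_scalar_mx scalerA divff// scale1r.
rewrite mul_mx_scalar linearZ/= scalerA divff// scale1r S'E.
by rewrite -scalemxAl -scalemxAr scalerA -invfM s2 addrCA subrr addr0.
Qed.

(** * Mean value theorem and Lipschitz bound *)

Lemma diff_coord_line {R : realType} {n : nat} {g : 'cV[R]_n -> 'cV[R]_n}
    (y v : 'cV[R]_n) (i : 'I_n) (t : R) :
  (forall x, differentiable g x) ->
  is_derive t 1 (fun s : R => g (y + s *: v) i ord0)
    ((Jmx g (y + t *: v) *m v) i ord0).
Proof.
move=> dg; pose gi (x : 'cV[R]_n) : R := g x i ord0.
have dgi x : differentiable gi x.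
  exact: (differentiable_comp (dg x) (differentiable_coord _ _ _)).
have JE x j : Jmx g x i j = 'd gi x (delta_mx j ord0).
  by rewrite mxE; exact: deriveE.
have dZ x (a : R) w : 'd gi x (a *: w) = a * 'd gi x w.
  by move: ('d gi x) => L; exact: linearZ_LR.
have -> x : (Jmx g x *m v) i ord0 = 'd gi x v.
  rewrite [in RHS](_ : v = \sum_j v j ord0 *: delta_mx j ord0); last first.
    by rewrite {1}[v]matrix_sum_delta; apply: eq_bigr => j _; rewrite big_ord1.
  rewrite linear_sum mxE; apply: eq_bigr => j _.
  by rewrite JE dZ mulrC.
have daff : is_diff t (fun s : R => y + s *: v) ( *:%R ^~ v).
  by have := is_diffD (is_diff_cst y t) (is_diff_scalel t v); rewrite add0r.
have dgi' : is_diff (y + t *: v) gi ('d gi (y + t *: v)) by apply: DiffDef.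
have [dh dE] := is_diff_comp daff dgi'.
have dh' : differentiable (fun s : R => g (y + s *: v) i ord0) t := dh.
split; first exact/derivable1_diffP.
transitivity ('D_1 (gi \o (fun s : R => y + s *: v)) t); first by [].
by rewrite (deriveE _ dh) dE /= scale1r.
Qed.

(** Pairing with a fixed [q] reduces to a scalar function on the segment from [y] to [x], so a
    single intermediate point serves all coordinates at once. *)
Lemma mean_value_dot {R : realType} {n : nat} {g : 'cV[R]_n -> 'cV[R]_n}
    (q x y : 'cV[R]_n) :
  (forall z, differentiable g z) ->
  exists z, dot q (g x - g y) = dot q (Jmx g z *m (x - y)).
Proof.
move=> dg; pose v := x - y.
pose h : R -> R :=
  \sum_(i < n) (q i ord0 *: (fun s : R => g (y + s *: v) i ord0)).
have hE s : h s = dot q (g (y + s *: v)).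
  by rewrite /h fct_sumE.
have dh (t : R) : is_derive t 1 h (dot q (Jmx g (y + t *: v) *m v)).
  by apply: is_derive_sum => i; apply: is_deriveZ; exact: diff_coord_line.
have [|t _ ht] := @MVT R h _ 0 1 ltr01 (fun t _ => dh t).
  apply: continuous_subspaceT => t; apply: differentiable_continuous.
  by apply/derivable1_diffP; case: (dh t).
exists (y + t *: v); rewrite dotBr; move: ht.
by rewrite subr0 mulr1 !hE scale1r scale0r addr0 {1}/v [y + _]addrC subrK.
Qed.

Lemma lipschitz_of_Jmx {R : realType} {n : nat} {g : 'cV[R]_n -> 'cV[R]_n}
    (S : 'M[R]_n) (r : R) :
  0 <= r -> (forall z, differentiable g z) ->
  (forall z v, enorm (S *m (Jmx g z *m v)) <= r * enorm (S *m v)) ->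
  forall x y, enorm (S *m (g x - g y)) <= r * enorm (S *m (x - y)).
Proof.
move=> r0 dg JS x y.
have dotS w u : dot w (S *m u) = dot (S^T *m w) u.
  by rewrite !dotE trmx_mul trmxK mulmxA.
(* Taking [q = S^T w] gives [dot w w = dot w (S J(z) (x - y))], whence [|w|] is at most
   [|S J(z) (x - y)|]. *)
set w := S *m (g x - g y); have [z zE] := mean_value_dot (S^T *m w) x y dg.
apply: le_trans (JS z _); apply: enorm_le_of_dot.
by rewrite [LHS]dotS zE -dotS.
Qed.

(** * Sequences with geometric increments *)

(** With [e m] the tail of the geometric series, the intervals [[a m - e m, a m + e m]] are nested;
    the supremum of their left ends lies in all of them. *)
Lemma geometric_increments_converge {R : realType} (r K : R) (a : nat -> R) :
  0 <= r < 1 -> (forall m, `|a m.+1 - a m| <= K * r ^+ m) ->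
  exists l, forall m, `|a m - l| <= K / (1 - r) * r ^+ m.
Proof.
move=> /andP[r0 r1] Ka; pose e m := K / (1 - r) * r ^+ m.
have eS m : e m = K * r ^+ m + e m.+1.
  by rewrite /e exprS; field; lra.
have e0 m : 0 <= e m.
  rewrite mulr_ge0 ?exprn_ge0// divr_ge0//; last by lra.
  (* [K] is nonnegative because it bounds an absolute value at index 0. *)
  by have := Ka 0; rewrite expr0 mulr1; apply: le_trans.
have lo : {homo (fun m => a m - e m) : m p / (m <= p)%N >-> m <= p}.
  apply: homo_leq => [//|? ? ?|m]; first exact: le_trans.
  by have := Ka m; rewrite ler_norml (eS m); lra.
have hi : {homo (fun m => a m + e m) : m p / (m <= p)%N >-> p <= m}.
  apply: homo_leq => [//|y x z xy yz|m]; first exact: le_trans yz xy.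
  by have := Ka m; rewrite ler_norml (eS m); lra.
have lohi m p : a m - e m <= a p + e p.
  apply: (le_trans (lo _ _ (leq_maxl m p))).
  apply: le_trans (hi _ _ (leq_maxr m p)).
  by have := e0 (maxn m p); lra.
pose A := range (fun m => a m - e m).
have A0 : A !=set0 by exists (a 0 - e 0); exists 0.
have ubA p : ubound A (a p + e p) by move=> _ [m _ <-].
exists (sup A) => m; rewrite ler_distlC; apply/andP; split.
  by apply: ub_le_sup; [exists (a 0 + e 0)|exists m].
exact: ge_sup.
Qed.

(** The scalar case is applied to each coordinate; the factor [n] comes from bounding the norm by
    the sum of the coordinates. *)
Lemma geometric_increments_converge_enorm {R : realType} {n : nat} (r K : R)
    (a : nat -> 'cV[R]_n) :
  0 <= r < 1 -> (forall m, enorm (a m.+1 - a m) <= K * r ^+ m) ->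
  exists l, forall m, enorm (a m - l) <= (K / (1 - r) *+ n) * r ^+ m.
Proof.
move=> r01 Ka.
have /choice[l lP] : forall i : 'I_n, exists l, forall m,
    `|a m i ord0 - l| <= K / (1 - r) * r ^+ m.
  move=> i; apply: geometric_increments_converge => // m.
  apply: le_trans (Ka m); apply: le_trans (coord_le_enorm _ i).
  by rewrite !mxE.
exists (\col_i l i) => m; apply: le_trans (enorm_le_sum _) _.
apply: (@le_trans _ _ (\sum_(i < n) K / (1 - r) * r ^+ m)).
  by apply: ler_sum => i _; rewrite !mxE.
by rewrite sumr_const card_ord mulrnAl.
Qed.

Lemma le0_geometric {R : realType} (r C y : R) :
  0 <= r < 1 -> (forall m, y <= C * r ^+ m) -> y <= 0.
Proof.
move=> /andP[r0 r1] yC.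
have cv : geometric C r x @[x --> \oo] --> 0.
  by apply: cvg_geometric; rewrite ger0_norm.
by apply: (cvgr_to_ge cv); apply: nearW => m; exact: yC.
Qed.

(** * Maps contracting in the norm [|S x|] *)

Section Contraction.
Context {R : realType} {n : nat}.
Context {f : int -> 'cV[R]_n -> 'cV[R]_n} {S : 'M[R]_n} {r : R}.
Hypotheses (S_unit : S \in unitmx) (r_gt0 : 0 < r) (r_lt1 : r < 1).
Hypothesis f_lip : forall k x y,
  enorm (S *m (f k x - f k y)) <= r * enorm (S *m (x - y)).

Let r01 : 0 <= r < 1. Proof. by rewrite ltW. Qed.

(** Time is counted in steps from [k0], so that this covers both trajectories [phi] and two-sided
    solutions restarted at any time. *)
Lemma solutions_contract (u v : nat -> 'cV[R]_n) (k0 : int) :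
  (forall m, u m.+1 = f (k0 + m%:Z) (u m)) ->
  (forall m, v m.+1 = f (k0 + m%:Z) (v m)) ->
  forall m, enorm (S *m (u m - v m)) <= r ^+ m * enorm (S *m (u 0 - v 0)).
Proof.
move=> uS vS; elim=> [|m IH]; first by rewrite expr0 mul1r.
rewrite uS vS (le_trans (f_lip _ _ _))// exprS -mulrA.
by rewrite ler_wpM2l// ltW.
Qed.

Lemma enorm_equiv : exists C1 C2 : R, [/\ 1 <= C1, 1 <= C2,
  forall x, enorm (S *m x) <= C1 * enorm x &
  forall x, enorm x <= C2 * enorm (S *m x)].
Proof.
have [C1 C1ge1 C1P] := enorm_mulmx S.
have [C2 C2ge1 C2P] := enorm_mulmx (invmx S).
by exists C1, C2; split=> // x; rewrite -{1}[x](mulKmx S_unit).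
Qed.

Lemma inc_exp_stable_of_lipschitz : inc_exp_stable f.
Proof.
have [C1 [C2 [C1ge1 C2ge1 C1P C2P]]] := enorm_equiv.
have C2ge0 : 0 <= C2 by exact: le_trans C2ge1.
(* Passing to [|S x|] costs [C1], returning costs [C2], and each step in between gains [r]. *)
exists (C2 * C1), r^-1; split; [by rewrite mulr_ege1|by rewrite invf_gt1|].
move=> xi1 xi2 k k0; rewrite -subr_ge0.
case: (k - k0) (subrK k0 k) => // m <- _.
have phiS xi p : phi f (k0 + p.+1%:Z) k0 xi =
    f (k0 + p%:Z) (phi f (k0 + p%:Z) k0 xi).
  by rewrite -phi_step ?lerDl// intS [1 + _]addrC addrA.
have /(_ m) := @solutions_contract (fun p => phi f (k0 + p%:Z) k0 xi1)
  (fun p => phi f (k0 + p%:Z) k0 xi2) k0 (phiS xi1) (phiS xi2).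
rewrite addr0 !phi_init => contr.
rewrite exprz_inv opprK -exprnP [m%:Z + k0]addrC (le_trans (C2P _))//.
rewrite -!mulrA ler_wpM2l// (le_trans contr)// mulrA [leRHS]mulrC.
by rewrite ler_wpM2l ?exprn_ge0// ltW.
Qed.

(** Go back [m] steps: at time [k - m] the solutions are at distance at most [M + N], so at time [k]
    at most a constant times [r ^+ m]. Let [m] grow. *)
Lemma bounded_solution_inj (u v : int -> 'cV[R]_n) :
  bounded_solution f u -> bounded_solution f v -> u = v.
Proof.
move=> [[M uM] uS] [[N vN] vS].
have [C1 [_ [C1ge1 _ C1P _]]] := enorm_equiv.
have C1ge0 : 0 <= C1 by exact: le_trans C1ge1.
apply/funext => k; apply/eqP; rewrite -subr_eq0.
rewrite -[_ - _](mulKmx S_unit); apply/eqP.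
suff /enorm_eq0 -> : enorm (S *m (u k - v k)) = 0 by rewrite mulmx0.
apply/le_anti; rewrite enorm_ge0 andbT.
apply: (@le0_geometric _ r (C1 * (M + N))) => // m.
have step w : (forall k, w (k + 1) = f k (w k)) -> forall p : nat,
    w (k - m%:Z + p.+1%:Z) = f (k - m%:Z + p%:Z) (w (k - m%:Z + p%:Z)).
  by move=> wS p; rewrite -wS intS [1 + _]addrC addrA.
have := solutions_contract _ _ _ (step u uS) (step v vS) m.
rewrite subrK addr0 => /le_trans; apply; rewrite mulrC.
rewrite ler_wpM2r ?exprn_ge0 ?(ltW r_gt0)// (le_trans (C1P _))// ler_wpM2l//.
by rewrite (le_trans (enormD _ _))// enormN lerD.
Qed.

(* The iterates, from the zero sequence, of [u |-> (k |-> f (k-1) (u (k-1)))],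
   whose fixed points are the solutions on all of Z. *)
Fixpoint picard (m : nat) (k : int) : 'cV[R]_n :=
  if m is m'.+1 then f (k - 1) (picard m' (k - 1)) else 0.

Lemma bounded_solution_exists (c : R) :
  (forall k, enorm (f k 0) <= c) -> exists u, bounded_solution f u.
Proof.
move=> fc.
have [C1 [C2 [C1ge1 C2ge1 C1P C2P]]] := enorm_equiv.
have C1ge0 : 0 <= C1 by exact: le_trans C1ge1.
have C2ge0 : 0 <= C2 by exact: le_trans C2ge1.
have r_ge0 := ltW r_gt0.
(* The first increment is [f (k - 1) 0], of norm at most [c]. Each iteration shifts time by one and
   gains [r], so the bound must be uniform in [k]. *)
have incr m k : enorm (S *m (picard m.+1 k - picard m k)) <= C1 * c * r ^+ m.
  elim: m k => [|m IH] k.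
    by rewrite /= subr0 expr0 mulr1 (le_trans (C1P _))// ler_wpM2l.
  rewrite (le_trans (f_lip _ _ _))// exprS mulrCA ler_wpM2l//.
  exact: IH.
pose K := (C2 * (C1 * c)) / (1 - r) *+ n.
have /choice[u uP] : forall k, exists l, forall m,
    enorm (picard m k - l) <= K * r ^+ m.
  move=> k; apply: geometric_increments_converge_enorm => // m.
  by rewrite (le_trans (C2P _))// -!mulrA ler_wpM2l// mulrA.
exists u; split=> [|k].
  (* The iterate of index 0 is zero, so the rate at [m = 0] already bounds [u], uniformly in [k]. *)
  by exists K => k; have := uP k 0; rewrite sub0r enormN mulr1.
apply/eqP; rewrite -subr_eq0 -[_ - _](mulKmx S_unit); apply/eqP.
suff /enorm_eq0 -> : enorm (S *m (u (k + 1) - f k (u k))) = 0 by rewrite mulmx0.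
apply/le_anti; rewrite enorm_ge0 andbT.
(* Insert [picard m.+1 (k + 1) = f k (picard m k)]: its distances to [u (k + 1)] and to [f k (u k)]
   in [|S x|] are each at most [C1 * K * r * r ^+ m]. *)
apply: (@le0_geometric _ r (C1 * K * r *+ 2)) => // m.
rewrite -[u _ - _](subrKA (picard m.+1 (k + 1))) mulmxDr.
rewrite (le_trans (enormD _ _))// mulr2n mulrDl lerD//.
  rewrite (le_trans (C1P _))// -!mulrA ler_wpM2l// -exprS enormB.
  exact: uP.
rewrite /= addrK (le_trans (f_lip _ _ _))//.
rewrite [_ * r]mulrC -!mulrA ler_wpM2l// (le_trans (C1P _))// ler_wpM2l//.
Qed.

Lemma exp_convergent_of_lipschitz {c : R} :
  (forall k, enorm (f k 0) <= c) -> exp_convergent f.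
Proof.
move=> /bounded_solution_exists[u uP]; exists u; split.
  by split=> // v vP; exact: bounded_solution_inj.
have [kappa [lambda [k1 l1 stab]]] := inc_exp_stable_of_lipschitz.
exists kappa, lambda; split=> // xi k k0 k0k.
(* A two-sided solution is the trajectory through any of its values, so convergence to it is
   incremental stability against the start [u k0]. *)
have -> : u k = phi f k k0 (u k0); last exact: stab.
move: k0k; rewrite -subr_ge0; case: (k - k0) (subrK k0 k) => // m <- _.
rewrite addrC; elim: m => [|m IH]; first by rewrite addr0 phi_init.
by rewrite intS [1 + _]addrC addrA phi_step ?lerDl// uP.2 IH.
Qed.

End Contraction.

(** * The contraction metric and the conclusion *)

Lemma contracting_of_gram {R : realType} {n : nat}
    {f : int -> 'cV[R]_n -> 'cV[R]_n} {S : 'M[R]_n} {rho : R} :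
  S \in unitmx -> rho < 1 ->
  (forall k x v, enorm (S *m (Jmx (f k) x *m v)) ^+ 2
     <= rho * enorm (S *m v) ^+ 2) ->
  contracting f.
Proof.
move=> Su rho1 JS.
have [C1 C1ge1 C1P] := enorm_mulmx S.
have [C2 C2ge1 C2P] := enorm_mulmx (invmx S).
have C2gt0 : 0 < C2 by apply: lt_le_trans C2ge1.
(* [C1] bounds [S] and gives [rho']; [C2] bounds its inverse and gives [eta]. *)
exists (fun _ _ => S), (1 - rho), (C2 ^- 2), (C1 ^+ 2); split=> //.
- by rewrite subr_gt0.
- by rewrite invr_gt0 exprn_gt0.
- by rewrite exprn_gt0// (lt_le_trans _ C1ge1).
move=> x k F; split=> v.
- rewrite qform_scalar qform_gram ler_pdivrMl ?exprn_gt0// -exprMn.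
  rewrite ler_pXn2r ?nnegrE ?mulr_ge0 ?enorm_ge0// ?(ltW C2gt0)//.
  by rewrite -{1}[v](mulKmx Su).
- rewrite qform_scalar qform_gram -exprMn.
  rewrite ler_pXn2r ?nnegrE ?mulr_ge0 ?enorm_ge0//.
  exact: le_trans C1ge1.
- rewrite qformB qformN !qform_scalar qform_gram /F -!mulmxA.
  (* Here [F = S J S^-1], so the hypothesis at [S^-1 v] reads [|F v|^2 <= rho |v|^2]. *)
  have := JS k x (invmx S *m v); rewrite mulKVmx//; lra.
Qed.

Theorem theorem14 (R : realType) (n : nat) (f : int -> 'cV[R]_n -> 'cV[R]_n)
  (f_cont : continuous (fun p : discrete_topology int * 'cV[R]_n => f p.1 p.2))
  (f_diff : forall (k : int) (x : 'cV[R]_n), differentiable (f k) x)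
  (f_C1 : forall k : int, continuous (Jmx (f k)))
  (P : 'M[R]_n) (P_posdef : posdefmx P)
  (rho : R) (rho_gt0 : 0 < rho) (rho_lt1 : rho < 1)
  (J_nsd : forall (k : int) (x : 'cV[R]_n),
     negsemidefmx ((Jmx (f k) x)^T *m P *m Jmx (f k) x - rho *: P)) :
  [/\ inc_exp_stable f,
      contracting f &
      (exists2 c : R, 0 <= c &
         ereal_sup [set (enorm (f k 0))%:E | k in [set: int]] = c%:E) ->
      exp_convergent f].
Proof.
have [S S_unit SP] := posdefmx_cholesky P_posdef.
have JS k x v : enorm (S *m (Jmx (f k) x *m v)) ^+ 2
    <= rho * enorm (S *m v) ^+ 2.
  have := J_nsd k x v.
  by rewrite qformB qform_congr qformZ -SP !qform_gram subr_le0.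
(* [rho] bounds squared norms, so the Lipschitz constant is its square root. *)
pose r := Num.sqrt rho.
have r_gt0 : 0 < r by rewrite sqrtr_gt0.
have r_lt1 : r < 1 by rewrite -sqrtr1 ltr_sqrt.
have r2 : r ^+ 2 = rho by rewrite sqr_sqrtr// ltW.
have f_lip k x y :
    enorm (S *m (f k x - f k y)) <= r * enorm (S *m (x - y)).
  apply: lipschitz_of_Jmx => [||z v]; [exact: ltW|exact: f_diff|].
  rewrite -(@ler_pXn2r _ 2)// ?nnegrE ?mulr_ge0 ?enorm_ge0// ?(ltW r_gt0)//.
  by rewrite exprMn r2.
split.
- exact: inc_exp_stable_of_lipschitz S_unit r_gt0 r_lt1 f_lip.
- exact: contracting_of_gram S_unit rho_lt1 JS.
- move=> [c _ supc].
  apply: (@exp_convergent_of_lipschitz _ _ _ _ _ S_unit r_gt0 r_lt1 f_lip c).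
  move=> k.
  by rewrite -lee_fin -supc; apply: ereal_sup_ubound; exists k.
Qed.
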